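(* Let $K$ be a field of characteristic not equal to $2$ and let $V$ be a $K$-vector space. Let $$\mathfrak{R}(V)= V\oplus\bigoplus_{n\geq 1}\bigl(\mathsf{Lie}_{n}(V)\otimes V\bigr),$$ and let $\pi:\mathsf{Leib}(V)=\bigoplus_{n\ge 1}V^{\otimes n}\to \mathfrak{R}(V)$ be the canonical linear map which is the identity on $V$ and which, for $n\ge 2$, is induced by the projection $$V^{\otimes n}\to \mathsf{Lie}_{n-1}(V)\otimes V,\qquad v_1\otimes\cdots\otimes v_n\mapsto \{\cdots\{\{v_1,v_2\},v_3\},\cdots, v_{n-1}\}\otimes v_n ,$$ where $\{-,-\}$ is the bracket of the free Lie algebra $\mathsf{Lie}(V)$ (for $n=2$ this map is the identity $v_1\otimes v_2\mapsto v_1\otimes v_2$ of $V\otimes V$). Then there exists a unique bracket (bilinear operation) $[-,-]$ on $\mathfrak{R}(V)$ such that $\pi$ preserves the bracket. Moreover, $\mathfrak{R}(V)$ with this bracket is a free Ronco algebra generated by $V$.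
   Context: All vector spaces and tensor products are over $K$. A Leibniz algebra is a vector space $\mathcal{L}$ with a bilinear operation $[-,-]$ satisfying $[x,[y,z]]=[[x,y],z]-[[x,z],y]$. The free Leibniz algebra generated by $V$ is $\mathsf{Leib}(V)=\bigoplus_{n\geq 1}V^{\otimes n}$ with the Leibniz bracket uniquely determined by $[\omega,v]=\omega\otimes v$ for $\omega\in V^{\otimes n}$, $n\ge 1$, $v\in V$. The free Lie algebra on $V$ is $\mathsf{Lie}(V)=\bigoplus_{n\ge1}\mathsf{Lie}_n(V)$, graded by bracket length, with $\mathsf{Lie}_1(V)=V$. A central extension of Leibniz algebras is a short exact sequence $0\to A\to\mathcal{L}\to\mathfrak{h}\to0$ of Leibniz algebras with $[A,\mathcal{L}]=0=[\mathcal{L},A]$. A Ronco algebra is a Leibniz algebra $\mathcal{L}$ for which there exists a central extension $0\to A\to\mathcal{L}\to\mathfrak{h}\to 0$ of Leibniz algebras with $\mathfrak{h}$ a Lie algebra. A Ronco algebra $F$ containing $V$ as a subspace is free generated by $V$ if every linear map from $V$ to a Ronco algebra $\mathfrak{h}$ extends uniquely to a Leibniz algebra homomorphism $F\to\mathfrak{h}$. *)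

(* Defs.v *)
From HB Require Import structures.
From mathcomp Require Import all_boot all_algebra boolp.

Set Implicit Arguments.
Unset Strict Implicit.
Unset Printing Implicit Defensive.

Import GRing.Theory.
Local Open Scope ring_scope.
Local Open Scope quotient_scope.

(* A bilinear operation is kept separate from its carrier, because the theorem
   is about the existence and uniqueness of a bracket on a fixed space. *)
Section Algebras.
Variable K : fieldType.

Definition is_bilinear (U V W : lmodType K) (f : U -> V -> W) : Prop :=
  (forall v, linear (f^~ v)) /\ (forall u, linear (f u)).

Definition is_leibniz (L : lmodType K) (br : L -> L -> L) : Prop :=
  is_bilinear br /\
  forall x y z, br x (br y z) = br (br x y) z - br (br x z) y.

Definition is_lie (L : lmodType K) (br : L -> L -> L) : Prop :=
  [/\ is_bilinear br, forall x, br x x = 0 &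
      forall x y z, br (br x y) z + br (br y z) x + br (br z x) y = 0].

Definition is_hom (L M : lmodType K) (brL : L -> L -> L) (brM : M -> M -> M)
    (f : L -> M) : Prop :=
  linear f /\ {morph f : x y / brL x y >-> brM x y}.

Record is_central_extension (A L h : lmodType K) (brA : A -> A -> A)
    (brL : L -> L -> L) (brh : h -> h -> h) (i : A -> L) (p : L -> h) : Prop :=
  CentralExtension {
    central_hom_i : is_hom brA brL i;
    central_hom_p : is_hom brL brh p;
    central_inj : injective i;
    central_exact : forall x, p x = 0 <-> exists a, i a = x;
    central_surj : forall y, exists x, p x = y;
    central_l : forall a x, brL (i a) x = 0;
    central_r : forall a x, brL x (i a) = 0 }.

Definition is_ronco (L : lmodType K) (br : L -> L -> L) : Prop :=
  is_leibniz br /\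
  exists (A h : lmodType K) (brA : A -> A -> A) (brh : h -> h -> h)
    (i : A -> L) (p : L -> h),
    [/\ is_leibniz brA, is_lie brh & is_central_extension brA br brh i p].

(* The inclusion of the generators is the injective linear map [i]. *)
Definition is_free_ronco (V F : lmodType K) (br : F -> F -> F) (i : V -> F) :
    Prop :=
  [/\ is_ronco br, linear i, injective i &
      forall (h : lmodType K) (brh : h -> h -> h), is_ronco brh ->
      forall f : V -> h, linear f ->
      exists! g : F -> h, is_hom br brh g /\ forall v, g (i v) = f v].

End Algebras.

Section UnbundledLinear.
Variables (K : fieldType) (U W : lmodType K) (g : U -> W).
Hypothesis h : linear g.
Lemma lin0 : g 0 = 0.
Proof. by have := h (-1) 0 0; rewrite !scaleN1r oppr0 addr0 addNr. Qed.
Lemma linD x y : g (x + y) = g x + g y.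
Proof. by have := h 1 x y; rewrite !scale1r. Qed.
Lemma linZ c x : g (c *: x) = c *: g x.
Proof. by have := h c x 0; rewrite !addr0 lin0 addr0. Qed.
Lemma linB x y : g (x - y) = g x - g y.
Proof. by rewrite addrC -scaleN1r h scaleN1r addrC. Qed.
End UnbundledLinear.

(* A (x) B: formal finite sums of pairs (a, b), two of them being identified
   when no bilinear map out of A x B separates them; tlift_pure, tlift_linear
   and tensor_ext give the universal property. *)
Section Tensor.
Variables (K : fieldType) (A B : lmodType K).

Definition teval (W : lmodType K) (f : A -> B -> W) (s : seq (A * B)) : W :=
  \sum_(p <- s) f p.1 p.2.

Definition tequiv (s t : seq (A * B)) : bool :=
  `[< forall (W : lmodType K) (f : A -> B -> W),
        is_bilinear f -> teval f s = teval f t >].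

Lemma tequiv_refl : reflexive tequiv.
Proof. by move=> s; apply/asboolP. Qed.
Lemma tequiv_sym : symmetric tequiv.
Proof.
by move=> s t; apply/asboolP/asboolP => h W f hf; rewrite (h W f hf).
Qed.
Lemma tequiv_trans : transitive tequiv.
Proof.
move=> t s u /asboolP st /asboolP tu; apply/asboolP => W f hf.
by rewrite (st W f hf) (tu W f hf).
Qed.

Canonical tequiv_equiv := EquivRel tequiv tequiv_refl tequiv_sym tequiv_trans.

Definition tensor : Type := {eq_quot tequiv}.
HB.instance Definition _ := Choice.on tensor.
HB.instance Definition _ := EqQuotient.on tensor.

Definition tlift (W : lmodType K) (f : A -> B -> W) (x : tensor) : W :=
  teval f (repr x).

Lemma tlift_pi (W : lmodType K) (f : A -> B -> W) s :
  is_bilinear f -> tlift f (\pi_tensor s) = teval f s.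
Proof.
move=> hf; rewrite /tlift.
have /eqmodP/asboolP : repr (\pi_tensor s) = s %[mod tensor] by rewrite reprK.
exact.
Qed.

Lemma tensor_eqP (x y : tensor) :
  (forall (W : lmodType K) (f : A -> B -> W),
     is_bilinear f -> tlift f x = tlift f y) -> x = y.
Proof.
move=> h; rewrite -[x]reprK -[y]reprK; apply/eqmodP/asboolP => W f hf.
exact: h.
Qed.

Lemma bil0l (W : lmodType K) (f : A -> B -> W) b : is_bilinear f -> f 0 b = 0.
Proof. by case=> h _; exact: (lin0 (h b)). Qed.
Lemma bil0r (W : lmodType K) (f : A -> B -> W) a : is_bilinear f -> f a 0 = 0.
Proof. by case=> _ h; exact: (lin0 (h a)). Qed.
Lemma bilZl (W : lmodType K) (f : A -> B -> W) c a b :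
  is_bilinear f -> f (c *: a) b = c *: f a b.
Proof. by case=> h _; exact: (linZ (h b)). Qed.

Definition tadd (x y : tensor) : tensor := \pi_tensor (repr x ++ repr y).
Definition tzero : tensor := \pi_tensor nil.
Definition tscale (c : K) (x : tensor) : tensor :=
  \pi_tensor [seq (c *: p.1, p.2) | p <- repr x].
Definition topp : tensor -> tensor := tscale (-1).
Definition pure (a : A) (b : B) : tensor := \pi_tensor [:: (a, b)].

Lemma tlift_pure (W : lmodType K) (f : A -> B -> W) a b :
  is_bilinear f -> tlift f (pure a b) = f a b.
Proof. by move=> hf; rewrite tlift_pi // /teval big_seq1. Qed.
Lemma tlift_add (W : lmodType K) (f : A -> B -> W) x y :
  is_bilinear f -> tlift f (tadd x y) = tlift f x + tlift f y.
Proof. by move=> hf; rewrite tlift_pi // /teval big_cat. Qed.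
Lemma tlift_zero (W : lmodType K) (f : A -> B -> W) :
  is_bilinear f -> tlift f tzero = 0.
Proof. by move=> hf; rewrite tlift_pi // /teval big_nil. Qed.
Lemma tlift_scale (W : lmodType K) (f : A -> B -> W) c x :
  is_bilinear f -> tlift f (tscale c x) = c *: tlift f x.
Proof.
move=> hf; rewrite tlift_pi // /tlift /teval big_map scaler_sumr.
by apply: eq_bigr => p _; rewrite bilZl.
Qed.
Lemma tlift_opp (W : lmodType K) (f : A -> B -> W) x :
  is_bilinear f -> tlift f (topp x) = - tlift f x.
Proof. by move=> hf; rewrite tlift_scale // scaleN1r. Qed.

Lemma taddA : associative tadd.
Proof. by move=> x y z; apply: tensor_eqP => W f hf; rewrite !tlift_add // addrA. Qed.
Lemma taddC : commutative tadd.
Proof. by move=> x y; apply: tensor_eqP => W f hf; rewrite !tlift_add // addrC. Qed.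
Lemma tadd0 : left_id tzero tadd.
Proof.
by move=> x; apply: tensor_eqP => W f hf; rewrite tlift_add // tlift_zero // add0r.
Qed.
Lemma taddN : left_inverse tzero topp tadd.
Proof.
move=> x; apply: tensor_eqP => W f hf.
by rewrite tlift_add // tlift_opp // tlift_zero // addNr.
Qed.
HB.instance Definition _ := GRing.isZmodule.Build tensor taddA taddC tadd0 taddN.

Lemma tscaleA a b x : tscale a (tscale b x) = tscale (a * b) x.
Proof. by apply: tensor_eqP => W f hf; rewrite !tlift_scale // scalerA. Qed.
Lemma tscale1 : left_id 1 tscale.
Proof. by move=> x; apply: tensor_eqP => W f hf; rewrite tlift_scale // scale1r. Qed.
Lemma tscaleDr : right_distributive tscale +%R.
Proof.
move=> a x y; apply: tensor_eqP => W f hf.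
by rewrite tlift_scale // !tlift_add // scalerDr !tlift_scale.
Qed.
Lemma tscaleDl x : {morph tscale^~ x : a b / a + b}.
Proof.
move=> a b; apply: tensor_eqP => W f hf.
by rewrite tlift_scale // tlift_add // scalerDl !tlift_scale.
Qed.
HB.instance Definition _ :=
  GRing.Zmodule_isLmodule.Build K tensor tscaleA tscale1 tscaleDr tscaleDl.

Lemma tlift_linear (W : lmodType K) (f : A -> B -> W) :
  is_bilinear f -> linear (tlift f).
Proof.
move=> hf c x y.
by rewrite -[c *: x + y]/(tadd (tscale c x) y) tlift_add // tlift_scale.
Qed.

Lemma pure_bilinear : is_bilinear pure.
Proof.
split=> [b|a] c u v; apply: tensor_eqP => W f hf;
  by rewrite (tlift_linear hf) !tlift_pure //; case: hf => hl hr; rewrite ?hl ?hr.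
Qed.

Lemma tensor_sum (x : tensor) : x = \sum_(p <- repr x) pure p.1 p.2.
Proof.
rewrite -{1}[x]reprK; elim: (repr x) => [|[a b] s IH].
  by rewrite big_nil.
rewrite big_cons -IH; apply: tensor_eqP => W f hf.
by rewrite -[pure _ _ + _]/(tadd _ _) tlift_add // tlift_pure // !tlift_pi //
           /teval big_cons.
Qed.

Lemma tensor_ext (W : lmodType K) (g1 g2 : tensor -> W) :
  linear g1 -> linear g2 ->
  (forall a b, g1 (pure a b) = g2 (pure a b)) -> g1 =1 g2.
Proof.
move=> h1 h2 e x; rewrite (tensor_sum x).
elim: (repr x) => [|p s IH]; first by rewrite big_nil !lin0.
by rewrite big_cons !linD // e IH.
Qed.

End Tensor.

Arguments pure {K A B} a b.

Definition tmap (K : fieldType) (A A' B B' : lmodType K)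
    (f : A -> A') (g : B -> B') : tensor A B -> tensor A' B' :=
  tlift (fun a b => pure (f a) (g b)).

Lemma tmap_bilinear (K : fieldType) (A A' B B' : lmodType K)
    (f : A -> A') (g : B -> B') :
  linear f -> linear g -> is_bilinear (fun a b => pure (f a) (g b)).
Proof.
have [hl hr] := @pure_bilinear K A' B'.
by move=> lf lg; split=> [b|a] c u v; rewrite ?lf ?lg ?hl ?hr.
Qed.

Section DirectSum.
Variables (K : fieldType) (M : nat -> lmodType K).

Record dsum : Type := DSum {
  dcoef :> forall n, M n;
  dcoef_fin : exists N, forall n, (N <= n)%N -> dcoef n = 0 }.

Lemma dsumP (x y : dsum) : (forall n, x n = y n) -> x = y.
Proof.
case: x y => [f hf] [g hg] /= e.
have {e} e : f = g by apply: functional_extensionality_dep.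
by case: g / e hg => hg; congr DSum; apply: Prop_irrelevance.
Qed.

HB.instance Definition _ := gen_eqMixin dsum.
HB.instance Definition _ := gen_choiceMixin dsum.

Lemma dzero_fin : exists N, forall n, (N <= n)%N -> (0 : M n) = 0.
Proof. by exists 0%N. Qed.
Definition dzero : dsum := DSum dzero_fin.

Lemma dopp_fin (x : dsum) : exists N, forall n, (N <= n)%N -> - x n = 0.
Proof. by have [N h] := dcoef_fin x; exists N => n /h ->; rewrite oppr0. Qed.
Definition dopp (x : dsum) : dsum := DSum (dopp_fin x).

Lemma dadd_fin (x y : dsum) : exists N, forall n, (N <= n)%N -> x n + y n = 0.
Proof.
have [N h] := dcoef_fin x; have [P k] := dcoef_fin y.
exists (maxn N P) => n; rewrite geq_max => /andP[/h -> /k ->].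
exact: addr0.
Qed.
Definition dadd (x y : dsum) : dsum := DSum (dadd_fin x y).

Lemma dscale_fin (c : K) (x : dsum) :
  exists N, forall n, (N <= n)%N -> c *: x n = 0.
Proof. by have [N h] := dcoef_fin x; exists N => n /h ->; rewrite scaler0. Qed.
Definition dscale (c : K) (x : dsum) : dsum := DSum (dscale_fin c x).

Lemma daddA : associative dadd.
Proof. by move=> x y z; apply: dsumP => n /=; rewrite addrA. Qed.
Lemma daddC : commutative dadd.
Proof. by move=> x y; apply: dsumP => n /=; rewrite addrC. Qed.
Lemma dadd0 : left_id dzero dadd.
Proof. by move=> x; apply: dsumP => n /=; rewrite add0r. Qed.
Lemma daddN : left_inverse dzero dopp dadd.
Proof. by move=> x; apply: dsumP => n /=; rewrite addNr. Qed.
HB.instance Definition _ := GRing.isZmodule.Build dsum daddA daddC dadd0 daddN.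

Lemma dscaleA a b x : dscale a (dscale b x) = dscale (a * b) x.
Proof. by apply: dsumP => n /=; rewrite scalerA. Qed.
Lemma dscale1 : left_id 1 dscale.
Proof. by move=> x; apply: dsumP => n /=; rewrite scale1r. Qed.
Lemma dscaleDr : right_distributive dscale +%R.
Proof. by move=> a x y; apply: dsumP => n /=; rewrite scalerDr. Qed.
Lemma dscaleDl x : {morph dscale^~ x : a b / a + b}.
Proof. by move=> a b; apply: dsumP => n /=; rewrite scalerDl. Qed.
HB.instance Definition _ :=
  GRing.Zmodule_isLmodule.Build K dsum dscaleA dscale1 dscaleDr dscaleDl.

Lemma dcoefD (x y : dsum) n : (x + y) n = x n + y n. Proof. by []. Qed.
Lemma dcoefZ c (x : dsum) n : (c *: x) n = c *: x n. Proof. by []. Qed.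
Lemma dcoef0 n : (0 : dsum) n = 0. Proof. by []. Qed.

Lemma dinj_fin n (u : M n) : exists N, forall k, (N <= k)%N ->
  dfwith (fun j => 0 : M j) u k = 0.
Proof.
by exists n.+1 => k nk; rewrite dfwith_out // neq_ltn nk.
Qed.
Definition dinj n (u : M n) : dsum := DSum (dinj_fin u).

Lemma dinj_linear n : linear (@dinj n).
Proof.
move=> c u v; apply: dsumP => k; rewrite dcoefD dcoefZ /=.
have [<-|nk] := eqVneq n k; first by rewrite !dfwith_in.
by rewrite !dfwith_out // scaler0 addr0.
Qed.

Definition dbound (x : dsum) : nat := projT1 (cid (dcoef_fin x)).

Definition dlift (W : lmodType K) (F : forall n, M n -> W) (x : dsum) : W :=
  \sum_(n < dbound x) F n (x n).

Section Lift.
Variables (W : lmodType K) (F : forall n, M n -> W).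
Hypothesis F_linear : forall n, linear (@F n).

Let F0 n : F (0 : M n) = 0.
Proof. exact: lin0 (@F_linear n). Qed.

Lemma dliftE (x : dsum) N :
  (forall n, (N <= n)%N -> x n = 0) -> dlift F x = \sum_(n < N) F (x n).
Proof.
have ext (P Q : nat) : (forall n, (P <= n)%N -> x n = 0) -> (P <= Q)%N ->
    \sum_(n < P) F (x n) = \sum_(n < Q) F (x n).
  move=> h PQ; rewrite (big_ord_widen Q (fun n => F (x n)) PQ) big_mkcond /=.
  apply: eq_bigr => n _; case: ltnP => // /h ->; by rewrite F0.
move=> hN; rewrite /dlift /dbound; case: cid => P /= hP.
by rewrite (ext P (maxn P N)) ?leq_maxl // (ext N (maxn P N)) // leq_maxr.
Qed.

Lemma dlift_linear : linear (dlift F).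
Proof.
move=> c x y; have [P hP] := dcoef_fin x; have [Q hQ] := dcoef_fin y.
have hx n : (maxn P Q <= n)%N -> x n = 0.
  by rewrite geq_max => /andP[/hP].
have hy n : (maxn P Q <= n)%N -> y n = 0.
  by rewrite geq_max => /andP[_ /hQ].
rewrite (dliftE hx) (dliftE hy) (@dliftE (c *: x + y) (maxn P Q)); last first.
  by move=> n hn; rewrite dcoefD dcoefZ hx // hy // scaler0 addr0.
rewrite scaler_sumr -big_split /=.
by apply: eq_bigr => n _; rewrite F_linear.
Qed.

Lemma dlift_dinj n (u : M n) : dlift F (dinj u) = F u.
Proof.
rewrite (@dliftE _ n.+1) => [|k nk]; last first.
  by rewrite /= dfwith_out // neq_ltn nk.
rewrite big_ord_recr /= dfwith_in big1 ?add0r // => k _.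
by rewrite dfwith_out ?F0 // neq_ltn ltn_ord orbT.
Qed.

End Lift.

Lemma dsum_sum (x : dsum) N : (forall n, (N <= n)%N -> x n = 0) ->
  x = \sum_(n < N) dinj (x n).
Proof.
move=> h; apply: dsumP => k.
have coef_sum (F : nat -> dsum) :
    (\sum_(n < N) F n) k = \sum_(n < N) (F n k).
  elim: N {h} => [|m IH]; first by rewrite !big_ord0.
  by rewrite !big_ord_recr dcoefD IH.
rewrite (coef_sum (fun n => dinj (x n))) /=; have [kN|Nk] := ltnP k N.
  rewrite (bigD1 (Ordinal kN)) //= dfwith_in big1 ?addr0 // => i ik.
  by rewrite dfwith_out //; apply: contra_neq ik => ik; apply: val_inj.
rewrite h // big1 // => i _.
by rewrite dfwith_out // neq_ltn (leq_trans (ltn_ord i) Nk).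
Qed.

Lemma dsum_ext (W : lmodType K) (g1 g2 : dsum -> W) :
  linear g1 -> linear g2 ->
  (forall n (u : M n), g1 (dinj u) = g2 (dinj u)) -> g1 =1 g2.
Proof.
move=> h1 h2 e x; have [N hN] := dcoef_fin x; rewrite (dsum_sum hN).
elim: N {hN} => [|m IH]; first by rewrite !big_ord0 !lin0.
by rewrite !big_ord_recr /= !linD // IH e.
Qed.

End DirectSum.

(* The free Lie algebra: Lie terms over V, two of them being identified when
   they take the same value for every linear map from V to a Lie algebra;
   lie_bracket_lie, llift_hom, llift_gen and lie_ext give the universal
   property. *)
Section FreeLie.
Variables (K : fieldType) (V : lmodType K).

Inductive lterm : Type :=
| LGen of V
| LZero
| LAdd of lterm & lterm
| LScale of K & lterm
| LBracket of lterm & lterm.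

HB.instance Definition _ := gen_eqMixin lterm.
HB.instance Definition _ := gen_choiceMixin lterm.

Fixpoint leval (L : lmodType K) (br : L -> L -> L) (f : V -> L) (t : lterm) : L :=
  match t with
  | LGen v => f v
  | LZero => 0
  | LAdd s t => leval br f s + leval br f t
  | LScale c t => c *: leval br f t
  | LBracket s t => br (leval br f s) (leval br f t)
  end.

Definition lequiv (s t : lterm) : bool :=
  `[< forall (L : lmodType K) (br : L -> L -> L) (f : V -> L),
        is_lie br -> linear f -> leval br f s = leval br f t >].

Lemma lequiv_refl : reflexive lequiv.
Proof. by move=> s; apply/asboolP. Qed.
Lemma lequiv_sym : symmetric lequiv.
Proof.
by move=> s t; apply/asboolP/asboolP => h L br f hb hf; rewrite (h L br f hb hf).
Qed.
Lemma lequiv_trans : transitive lequiv.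
Proof.
move=> t s u /asboolP st /asboolP tu; apply/asboolP => L br f hb hf.
by rewrite (st L br f hb hf) (tu L br f hb hf).
Qed.

Canonical lequiv_equiv := EquivRel lequiv lequiv_refl lequiv_sym lequiv_trans.

Definition Lie : Type := {eq_quot lequiv}.
HB.instance Definition _ := Choice.on Lie.
HB.instance Definition _ := EqQuotient.on Lie.

Definition llift (L : lmodType K) (br : L -> L -> L) (f : V -> L) (x : Lie) : L :=
  leval br f (repr x).

Lemma llift_pi (L : lmodType K) (br : L -> L -> L) (f : V -> L) t :
  is_lie br -> linear f -> llift br f (\pi_Lie t) = leval br f t.
Proof.
move=> hb hf; rewrite /llift.
have /eqmodP/asboolP : repr (\pi_Lie t) = t %[mod Lie] by rewrite reprK.
exact.
Qed.

Lemma Lie_eqP (x y : Lie) :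
  (forall (L : lmodType K) (br : L -> L -> L) (f : V -> L),
     is_lie br -> linear f -> llift br f x = llift br f y) -> x = y.
Proof.
move=> h; rewrite -[x]reprK -[y]reprK; apply/eqmodP/asboolP => L br f hb hf.
exact: h.
Qed.

Definition lzero : Lie := \pi_Lie LZero.
Definition ladd (x y : Lie) : Lie := \pi_Lie (LAdd (repr x) (repr y)).
Definition lscale (c : K) (x : Lie) : Lie := \pi_Lie (LScale c (repr x)).
Definition lopp : Lie -> Lie := lscale (-1).
Definition lie_bracket (x y : Lie) : Lie := \pi_Lie (LBracket (repr x) (repr y)).
Definition lie_gen (v : V) : Lie := \pi_Lie (LGen v).

Section LiftLemmas.
Variables (L : lmodType K) (br : L -> L -> L) (f : V -> L).
Hypotheses (hb : is_lie br) (hf : linear f).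
Lemma llift_gen v : llift br f (lie_gen v) = f v.
Proof. by rewrite llift_pi. Qed.
Lemma llift_zero : llift br f lzero = 0.
Proof. by rewrite llift_pi. Qed.
Lemma llift_add x y : llift br f (ladd x y) = llift br f x + llift br f y.
Proof. by rewrite llift_pi. Qed.
Lemma llift_scale c x : llift br f (lscale c x) = c *: llift br f x.
Proof. by rewrite llift_pi. Qed.
Lemma llift_opp x : llift br f (lopp x) = - llift br f x.
Proof. by rewrite llift_scale scaleN1r. Qed.
Lemma llift_bracket x y :
  llift br f (lie_bracket x y) = br (llift br f x) (llift br f y).
Proof. by rewrite llift_pi. Qed.
End LiftLemmas.

Lemma laddA : associative ladd.
Proof. by move=> x y z; apply: Lie_eqP => *; rewrite !llift_add // addrA. Qed.
Lemma laddC : commutative ladd.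
Proof. by move=> x y; apply: Lie_eqP => *; rewrite !llift_add // addrC. Qed.
Lemma ladd0 : left_id lzero ladd.
Proof.
by move=> x; apply: Lie_eqP => *; rewrite llift_add // llift_zero // add0r.
Qed.
Lemma laddN : left_inverse lzero lopp ladd.
Proof.
move=> x; apply: Lie_eqP => *.
by rewrite llift_add // llift_opp // llift_zero // addNr.
Qed.
HB.instance Definition _ := GRing.isZmodule.Build Lie laddA laddC ladd0 laddN.

Lemma lscaleA a b x : lscale a (lscale b x) = lscale (a * b) x.
Proof. by apply: Lie_eqP => *; rewrite !llift_scale // scalerA. Qed.
Lemma lscale1 : left_id 1 lscale.
Proof. by move=> x; apply: Lie_eqP => *; rewrite llift_scale // scale1r. Qed.
Lemma lscaleDr : right_distributive lscale +%R.
Proof.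
move=> a x y; apply: Lie_eqP => *.
by rewrite llift_scale // !llift_add // scalerDr !llift_scale.
Qed.
Lemma lscaleDl x : {morph lscale^~ x : a b / a + b}.
Proof.
move=> a b; apply: Lie_eqP => *.
by rewrite llift_scale // llift_add // scalerDl !llift_scale.
Qed.
HB.instance Definition _ :=
  GRing.Zmodule_isLmodule.Build K Lie lscaleA lscale1 lscaleDr lscaleDl.

Lemma llift_linear (L : lmodType K) (br : L -> L -> L) (f : V -> L) :
  is_lie br -> linear f -> linear (llift br f).
Proof.
move=> hb hf c x y.
by rewrite -[c *: x + y]/(ladd (lscale c x) y) llift_add // llift_scale.
Qed.

Lemma llift_hom (L : lmodType K) (br : L -> L -> L) (f : V -> L) :
  is_lie br -> linear f -> is_hom lie_bracket br (llift br f).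
Proof.
move=> hb hf; split; first exact: llift_linear.
by move=> x y; exact: llift_bracket.
Qed.

Lemma lie_gen_linear : linear lie_gen.
Proof.
move=> c u v; apply: Lie_eqP => L br f hb hf.
by rewrite (llift_linear hb hf) !llift_gen // hf.
Qed.

Lemma lie_bracket_lie : is_lie lie_bracket.
Proof.
split.
- split=> [y|x] c u v; apply: Lie_eqP => L br f hb hf;
    rewrite (llift_linear hb hf) !llift_bracket // (llift_linear hb hf);
    by case: hb => [[hl hr] _ _]; rewrite ?hl ?hr.
- move=> x; apply: Lie_eqP => L br f hb hf.
  by rewrite -[0]/lzero llift_bracket // llift_zero //; case: hb => _ ->.
- move=> x y z; apply: Lie_eqP => L br f hb hf.
  rewrite -[0]/lzero -[lie_bracket _ _ + _ + _]/(ladd (ladd _ _) _).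
  rewrite !llift_add // !llift_bracket // llift_zero //.
  by case: hb => _ _ ->.
Qed.

Lemma lie_ext (L : lmodType K) (br : L -> L -> L) (g1 g2 : Lie -> L) :
  is_hom lie_bracket br g1 -> is_hom lie_bracket br g2 ->
  (forall v, g1 (lie_gen v) = g2 (lie_gen v)) -> g1 =1 g2.
Proof.
move=> [l1 m1] [l2 m2] e x.
rewrite -[x]reprK; elim: (repr x) => [v||s IHs t IHt|c t IHt|s IHs t IHt].
- exact: e.
- by rewrite -[\pi_Lie LZero]/(0 : Lie) !lin0.
- have -> : \pi_Lie (LAdd s t) = \pi_Lie s + \pi_Lie t.
    apply: Lie_eqP => A b f hb hf.
    by rewrite -[_ + _]/(ladd _ _) llift_add // !llift_pi.
  by rewrite !linD // IHs IHt.
- have -> : \pi_Lie (LScale c t) = c *: \pi_Lie t.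
    apply: Lie_eqP => A b f hb hf.
    by rewrite -[_ *: _]/(lscale _ _) llift_scale // !llift_pi.
  by rewrite !linZ // IHt.
- have -> : \pi_Lie (LBracket s t) = lie_bracket (\pi_Lie s) (\pi_Lie t).
    by apply: Lie_eqP => A b f hb hf; rewrite llift_bracket // !llift_pi.
  by rewrite m1 m2 IHs IHt.
Qed.

(* lie_deg n is the span of the brackets of n generators. *)
Inductive lie_deg : nat -> Lie -> Prop :=
| lie_deg_gen v : lie_deg 1 (lie_gen v)
| lie_deg_bracket m n x y :
    lie_deg m x -> lie_deg n y -> lie_deg (m + n) (lie_bracket x y)
| lie_deg_zero n : lie_deg n 0
| lie_deg_lin n c x y : lie_deg n x -> lie_deg n y -> lie_deg n (c *: x + y).

Section LiePart.
Variable n : nat.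

Definition lie_degb : pred Lie := fun x => `[< lie_deg n x >].

Lemma lie_degb_submod : submod_closed lie_degb.
Proof.
split=> [|c x y /asboolP hx /asboolP hy]; apply/asboolP.
  exact: lie_deg_zero.
exact: lie_deg_lin.
Qed.
HB.instance Definition _ := GRing.isSubmodClosed.Build K Lie lie_degb lie_degb_submod.

Record Lie_ : Type := LiePart { lie_val :> Lie; _ : lie_val \in lie_degb }.
HB.instance Definition _ := [isSub for lie_val].
HB.instance Definition _ := [Choice of Lie_ by <:].
HB.instance Definition _ := [SubChoice_isSubLmodule of Lie_ by <:].

Lemma Lie_P (x : Lie_) : lie_deg n x.
Proof. by case: x => x /= /asboolP. Qed.
Definition lie_part (x : Lie) (hx : lie_deg n x) : Lie_ :=
  LiePart (introT (asboolP _) hx).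

End LiePart.

End FreeLie.

Section Ronco.
Variables (K : fieldType) (V : lmodType K).

(* Tensor powers are indexed from 0: tpow n is the (n+1)-st tensor power, so
   that v_0 (x) ... (x) v_n is built by successive tensoring on the right. *)
Fixpoint tpow (n : nat) : lmodType K :=
  if n is m.+1 then tensor (tpow m) V else V.

Definition Leib : lmodType K := dsum tpow.

Lemma leib_shift_fin (w : Leib) (v : V) : exists N, forall n, (N <= n)%N ->
  (match n return tpow n with 0 => 0 | m.+1 => pure (w m) v end) = 0.
Proof.
have [N h] := dcoef_fin w; exists N.+1 => -[//|n] /h ->.
exact: bil0l (pure_bilinear _ _).
Qed.
(* w |-> w (x) v *)
Definition leib_shift (w : Leib) (v : V) : Leib := DSum (leib_shift_fin w v).

(* Right multiplication by an element of tpow n, following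
   [w, a (x) v] = [w, [a, v]] = [[w, a], v] - [[w, v], a]. *)
Fixpoint leib_rmul (n : nat) : tpow n -> Leib -> Leib :=
  match n return tpow n -> Leib -> Leib with
  | 0 => fun v w => leib_shift w v
  | m.+1 => fun t w =>
      tlift (fun (a : tpow m) (v : V) =>
        leib_shift (leib_rmul a w) v - leib_rmul a (leib_shift w v)) t
  end.

(* The bracket of the free Leibniz algebra; by leib_bracket_leibniz,
   leib_bracket_gen and leib_bracket_unique it is the only Leibniz bracket
   with [w, v] = w (x) v. *)
Definition leib_bracket (x y : Leib) : Leib :=
  dlift (fun n t => @leib_rmul n t x) y.

Definition leib_gen (v : V) : Leib := @dinj K tpow 0 v.

Lemma leib_shift_bilinear : is_bilinear leib_shift.
Proof.
have hp n := @pure_bilinear K (tpow n) V.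
split=> [v|w] c a b; apply: dsumP => -[|n].
- by rewrite dcoefD dcoefZ /= scaler0 addr0.
- by rewrite dcoefD dcoefZ /= (hp n).1.
- by rewrite dcoefD dcoefZ /= scaler0 addr0.
- by rewrite dcoefD dcoefZ /= (hp n).2.
Qed.

Lemma leib_rmul_bilinear n : is_bilinear (@leib_rmul n).
Proof.
have [sl sr] := leib_shift_bilinear.
elim: n => [|n [IHl IHr]]; first by split.
have hb w : is_bilinear (fun (a : tpow n) (v : V) =>
    leib_shift (leib_rmul a w) v - leib_rmul a (leib_shift w v)).
  split=> [v|a] c x y /=.
    by rewrite !IHl sl scalerBr opprD addrACA.
  by rewrite !sr IHr scalerBr opprD addrACA.
split=> [w|t]; first exact: tlift_linear (hb w).
move=> c x y.
pose F w := @leib_rmul n.+1 ^~ w : tensor (tpow n) V -> Leib.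
have lF w : linear (F w) by exact: tlift_linear (hb w).
apply: (@tensor_ext K (tpow n) V Leib (F (c *: x + y))
          (fun t => c *: F x t + F y t) (lF _)).
  move=> d s1 s2; rewrite !lF !scalerDr !scalerA mulrC !addrA.
  by congr (_ + _); rewrite -!addrA; congr (_ + _); rewrite addrC.
move=> a v; rewrite /F /= !tlift_pure // IHr !sl IHr scalerBr opprD.
by rewrite addrACA.
Qed.

Lemma leib_rmulS_bilinear n w : is_bilinear (fun (a : tpow n) (v : V) =>
    leib_shift (leib_rmul a w) v - leib_rmul a (leib_shift w v)).
Proof.
have [sl sr] := leib_shift_bilinear.
have [IHl IHr] := @leib_rmul_bilinear n.
split=> [v|a] c x y /=.
  by rewrite !IHl sl scalerBr opprD addrACA.
by rewrite !sr IHr scalerBr opprD addrACA.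
Qed.

Lemma leib_bracket_dinj w n (t : tpow n) :
  leib_bracket w (dinj t) = leib_rmul t w.
Proof.
rewrite /leib_bracket dlift_dinj // => k.
exact: (@leib_rmul_bilinear k).1.
Qed.

Lemma leib_shift_dinj n (t : tpow n) (v : V) :
  leib_shift (dinj t) v = @dinj K tpow n.+1 (pure t v).
Proof.
apply: dsumP => -[|k] /=; first by rewrite dfwith_out.
have [<-|nk] := eqVneq n k; first by rewrite !dfwith_in.
by rewrite !dfwith_out ?eqSS // (bil0l _ (pure_bilinear _ _)).
Qed.

Lemma leib_bracket_bilinear : is_bilinear leib_bracket.
Proof.
split=> [y|x]; last first.
  by apply: dlift_linear => n; exact: (@leib_rmul_bilinear n).1.
move=> c x x'; rewrite /leib_bracket /dlift scaler_sumr -big_split /=.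
by apply: eq_bigr => n _; rewrite (@leib_rmul_bilinear n).2.
Qed.

Lemma leib_bracket_shift w v : leib_bracket w (leib_gen v) = leib_shift w v.
Proof. by rewrite /leib_gen leib_bracket_dinj. Qed.

Lemma leib_bracket_gen n (t : tpow n) (v : V) :
  leib_bracket (dinj t) (leib_gen v) = @dinj K tpow n.+1 (pure t v).
Proof. by rewrite leib_bracket_shift leib_shift_dinj. Qed.

Lemma leib_bracket_leibniz : is_leibniz leib_bracket.
Proof.
have [bl br] := leib_bracket_bilinear.
split; first by split.
have [sl sr] := leib_shift_bilinear.
have brB x y z : leib_bracket x (y - z) = leib_bracket x y - leib_bracket x z.
  by rewrite addrC -scaleN1r br scaleN1r addrC.
have blB x y z : leib_bracket (y - z) x = leib_bracket y x - leib_bracket z x.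
  by rewrite addrC -scaleN1r bl scaleN1r addrC.
have lin_sub (A B : lmodType K) (f g : A -> B) :
    linear f -> linear g -> linear (fun x => f x - g x).
  by move=> lf lg c u v; rewrite lf lg scalerBr opprD addrACA.
have lin_comp (A B C : lmodType K) (f : B -> C) (g : A -> B) :
    linear f -> linear g -> linear (fun x => f (g x)).
  by move=> lf lg c u v; rewrite lg lf.
have gen x y v : leib_bracket x (leib_bracket y (leib_gen v)) =
    leib_bracket (leib_bracket x y) (leib_gen v)
    - leib_bracket (leib_bracket x (leib_gen v)) y.
  pose g1 y := leib_bracket x (leib_bracket y (leib_gen v)).
  pose g2 y := leib_bracket (leib_bracket x y) (leib_gen v)
    - leib_bracket (leib_bracket x (leib_gen v)) y.
  apply: (@dsum_ext K tpow Leib g1 g2) y; rewrite /g1 /g2.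
  - exact: (lin_comp _ _ _ (leib_bracket x)).
  - apply: lin_sub => //.
    exact: (lin_comp _ _ _ (leib_bracket ^~ (leib_gen v))).
  move=> n t; rewrite leib_bracket_gen !leib_bracket_dinj /=.
  rewrite tlift_pure ?leib_bracket_shift //.
  exact: leib_rmulS_bilinear.
move=> x y z.
suff H n (t : tpow n) a b : leib_bracket a (leib_bracket b (dinj t)) =
    leib_bracket (leib_bracket a b) (dinj t)
    - leib_bracket (leib_bracket a (dinj t)) b.
  pose g1 z := leib_bracket x (leib_bracket y z).
  pose g2 z := leib_bracket (leib_bracket x y) z
    - leib_bracket (leib_bracket x z) y.
  apply: (@dsum_ext K tpow Leib g1 g2) z; rewrite /g1 /g2.
  - exact: lin_comp.
  - apply: lin_sub => //.
    exact: (lin_comp _ _ _ (leib_bracket ^~ y)).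
  by move=> n t; exact: H.
elim: n t a b => [|n IH] t a b; first exact: gen.
pose g1 (t : tensor (tpow n) V) :=
  leib_bracket a (leib_bracket b (@dinj K tpow n.+1 t)).
pose g2 (t : tensor (tpow n) V) :=
  leib_bracket (leib_bracket a b) (@dinj K tpow n.+1 t)
    - leib_bracket (leib_bracket a (@dinj K tpow n.+1 t)) b.
have dl : linear (@dinj K tpow n.+1) by exact: dinj_linear.
apply: (@tensor_ext K (tpow n) V Leib g1 g2) t.
- by move=> c u v; rewrite /g1 dl !br.
- by move=> c u v; rewrite /g2 dl !br bl scalerBr opprD addrACA.
move=> s v; rewrite /g1 /g2 -!leib_bracket_gen.
have -> : leib_bracket (leib_bracket a (leib_bracket (dinj s) (leib_gen v))) b =
  leib_bracket (leib_bracket (leib_bracket a (dinj s)) (leib_gen v)) b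
  - leib_bracket (leib_bracket (leib_bracket a (leib_gen v)) (dinj s)) b.
  by rewrite gen blB.
rewrite (gen (leib_bracket a b)) (gen b) brB (gen a (leib_bracket b (dinj s))).
rewrite (IH s a (leib_bracket b _)) (IH s a b) (gen a b v) !blB.
rewrite (IH s (leib_bracket a (leib_gen v)) b).
rewrite (gen (leib_bracket a (dinj s)) b v) !opprB addrACA !addrA !subrK.
by rewrite -!addrA; congr (_ + _); rewrite addrCA [RHS]addrCA; congr (_ + _); rewrite addrC.
Qed.

Lemma leib_bracket_unique (br : Leib -> Leib -> Leib) :
  is_leibniz br ->
  (forall n (t : tpow n) (v : V),
     br (dinj t) (leib_gen v) = @dinj K tpow n.+1 (pure t v)) ->
  br = leib_bracket.
Proof.
move=> [[bl br'] leib] gen; have [[bl0 br0] leib0] := leib_bracket_leibniz.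
have shift w v : br w (leib_gen v) = leib_bracket w (leib_gen v).
  apply: (@dsum_ext K tpow Leib (br ^~ (leib_gen v))
    (leib_bracket ^~ (leib_gen v))) w => // n t.
  by rewrite gen leib_bracket_gen.
apply: funext => x; apply: funext => y.
apply: (@dsum_ext K tpow Leib (br x) (leib_bracket x)) y => // n.
elim: n x => [|n IH] x t; first exact: shift.
have dl : linear (@dinj K tpow n.+1) by exact: dinj_linear.
apply: (@tensor_ext K (tpow n) V Leib (fun t => br x (@dinj K tpow n.+1 t))
  (fun t => leib_bracket x (@dinj K tpow n.+1 t))) t.
- by move=> c u v; rewrite dl br'.
- by move=> c u v; rewrite dl br0.
move=> a v; rewrite -{1}gen -leib_bracket_gen leib leib0.
by rewrite !shift !IH.
Qed.

Lemma lie_deg_bracket_gen n (x : Lie_ V n) (v : V) :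
  lie_deg n.+1 (lie_bracket x (lie_gen v)).
Proof.
by rewrite -addn1; apply: lie_deg_bracket (Lie_P x) (lie_deg_gen v).
Qed.

(* v_0 (x) ... (x) v_n |-> {..{{v_0, v_1}, v_2}.., v_n} *)
Fixpoint lie_iter (n : nat) : tpow n -> Lie_ V n.+1 :=
  match n return tpow n -> Lie_ V n.+1 with
  | 0 => fun v => lie_part (lie_deg_gen v)
  | m.+1 => tlift (fun (a : tpow m) (v : V) =>
      lie_part (lie_deg_bracket_gen (lie_iter a) v))
  end.

Lemma lie_iterS_bilinear n : linear (@lie_iter n) ->
  is_bilinear (fun (a : tpow n) (v : V) =>
    lie_part (lie_deg_bracket_gen (lie_iter a) v)).
Proof.
have [[bl br] _ _] := lie_bracket_lie V.
move=> li; split=> [v|a] c x y; apply: val_inj; rewrite /= ?linearP /=.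
  by rewrite li /= bl.
by rewrite lie_gen_linear br.
Qed.

Lemma lie_iter_linear n : linear (@lie_iter n).
Proof.
elim: n => [|n IH]; last exact: tlift_linear (lie_iterS_bilinear IH).
by move=> c u v; apply: val_inj; rewrite /= lie_gen_linear.
Qed.

Lemma lie_iter_pure n (a : tpow n) (v : V) :
  lie_val (@lie_iter n.+1 (pure a v)) = lie_bracket (lie_iter a) (lie_gen v).
Proof.
by rewrite /= tlift_pure //; apply: lie_iterS_bilinear; apply: lie_iter_linear.
Qed.

(* Lie_ V 1 is V, through v |-> lie_gen v; hence the component of ronco_proj in
   tensor degree 2 is the identity of V (x) V. *)
Lemma lie_iter0_bij : injective (@lie_iter 0) /\
  forall x : Lie_ V 1, exists v : V, x = @lie_iter 0 v.
Proof.
split=> [u v /(congr1 (@lie_val K V 1)) /= uv|x].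
  pose ab (x y : V) : V := 0.
  have hab : is_lie ab.
    split=> //; last by move=> *; rewrite !addr0.
    by split=> ? ? ? ?; rewrite /ab scaler0 addr0.
  by rewrite -(llift_gen hab (f := id) _ u) // uv llift_gen.
have H n y : lie_deg n y ->
    (n = 0%N -> y = 0) /\ (n = 1%N -> exists v : V, y = lie_gen v).
  have [[bl br] _ _] := lie_bracket_lie V.
  have gen0 : 0 = lie_gen (0 : V) by rewrite (lin0 (@lie_gen_linear K V)).
  elim=> {n y} [v|m n y z _ [IHy _] _ [IHz _]|n|n c y z _ [y0 y1] _ [z0 z1]].
  - by split=> // _; exists v.
  - have br0 : (m = 0%N) \/ (n = 0%N) -> lie_bracket y z = 0.
      by case=> [/IHy ->|/IHz ->]; [apply: (lin0 (bl z))|apply: (lin0 (br y))].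
    split=> mn; first by apply: br0; left; case: m mn {IHy}.
    exists 0; rewrite -gen0; apply: br0.
    by case: m mn {IHy} => [|[|m]] mn; [left|right; case: n mn {IHz}|].
  - by split=> // _; exists 0.
  - split=> [n0|n1]; first by rewrite y0 // z0 // scaler0 addr0.
    have [u ->] := y1 n1; have [v ->] := z1 n1.
    by exists (c *: u + v); rewrite lie_gen_linear.
have [_ /(_ erefl) [v xv]] := H _ _ (Lie_P x).
by exists v; apply: val_inj.
Qed.

(* The summand of index n of Ronco_sum is Lie_{n+1}(V) (x) V. *)
Definition Ronco_sum : lmodType K := dsum (fun n => tensor (Lie_ V n.+1) V).
Definition Ronco : lmodType K := (V * Ronco_sum)%type.
Definition ronco_gen (v : V) : Ronco := (v, 0).

Definition ronco_proj_comp (n : nat) : tpow n.+1 -> tensor (Lie_ V n.+1) V :=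
  tmap (@lie_iter n) id.

Lemma ronco_proj_comp_linear n : linear (@ronco_proj_comp n).
Proof. by apply: tlift_linear; apply: tmap_bilinear => //; apply: lie_iter_linear. Qed.

Lemma ronco_proj_fin (x : Leib) : exists N, forall n, (N <= n)%N ->
  ronco_proj_comp (x n.+1) = 0.
Proof.
have [N h] := dcoef_fin x; exists N => n Nn.
by rewrite h ?(leqW Nn) // (lin0 (@ronco_proj_comp_linear n)).
Qed.

Definition ronco_proj (x : Leib) : Ronco := (x 0%N, DSum (ronco_proj_fin x)).

Lemma ronco_proj_linear : linear ronco_proj.
Proof.
move=> c x y; congr (_, _); apply: dsumP => n /=.
by rewrite ronco_proj_comp_linear.
Qed.

Lemma ronco_proj_gen v : ronco_proj (leib_gen v) = ronco_gen v.
Proof.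
congr (_, _); first by rewrite /= dfwith_in.
apply: dsumP => n /=.
by rewrite dfwith_out // (lin0 (@ronco_proj_comp_linear n)).
Qed.

Lemma ronco_proj_pure n (a : tpow n) (v : V) :
  ronco_proj (@dinj K tpow n.+1 (pure a v)) =
  (0, @dinj K (fun n => tensor (Lie_ V n.+1) V) n (pure (lie_iter a) v)).
Proof.
congr (_, _); first by rewrite /= dfwith_out.
apply: dsumP => k /=; have [<-|nk] := eqVneq n k.
  rewrite !dfwith_in /ronco_proj_comp /tmap tlift_pure //.
  by apply: tmap_bilinear => //; apply: lie_iter_linear.
by rewrite !dfwith_out ?eqSS // (lin0 (@ronco_proj_comp_linear k)).
Qed.

End Ronco.

(* Main.v *)
(* Let N be the kernel of the graded map lie_proj from Leib(V) to the sum of the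
   Lie_n(V). Then ker pi is contained in N. Moreover [N, Leib(V)] lies in ker pi,
   since x (x) v is killed by pi when x is in N, and [Leib(V), N] = 0, since right
   multiplications form a representation of a Lie algebra and hence factor
   through the free Lie algebra. So the bracket descends to R(V), and to the sum of the
   Lie_n(V), where it is alternating because it is antisymmetric and 2 is
   invertible; the kernel of R(V) -> (+) Lie_n(V) is then central.
   For freeness, the bracket of a Ronco algebra only depends on the images of its
   arguments in the Lie quotient, so the homomorphism from Leib(V) extending a
   linear map V -> h vanishes on ker pi. *)
Require Import Defs.
From HB Require Import structures.
From mathcomp Require Import all_boot all_algebra boolp functions.

Set Implicit Arguments.
Unset Strict Implicit.
Unset Printing Implicit Defensive.

Import GRing.Theory.
Local Open Scope ring_scope.

(** * Descent of linear and bilinear maps along a linear surjection *)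

Section Descent.
Variables (K : fieldType) (A B : lmodType K) (p : A -> B).
Hypotheses (p_lin : linear p) (p_surj : forall y, exists x, p x = y).

(** Choice gives a section [s] of [p], not linear in general; two lifts of one point differ by an
    element of the kernel of [p], so [f] agrees on them. *)
Lemma descend_linear (C : lmodType K) (f : A -> C) :
  linear f -> (forall x, p x = 0 -> f x = 0) ->
  exists2 g : B -> C, linear g & forall x, g (p x) = f x.
Proof.
move=> f_lin kf; have [s sK] := choice p_surj.
have fs x y : p x = p y -> f x = f y.
  move=> pxy; apply: subr0_eq; rewrite -(linB f_lin) kf //.
  by rewrite (linB p_lin) pxy subrr.
exists (f \o s) => [c u v|x] /=; last by apply: fs; rewrite sK.
by rewrite -f_lin; apply: fs; rewrite p_lin !sK.
Qed.

Lemma descend_bilinear (C : lmodType K) (f : A -> A -> C) :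
  is_bilinear f ->
  (forall x y, p x = 0 -> f x y = 0) -> (forall x y, p y = 0 -> f x y = 0) ->
  exists2 g : B -> B -> C, is_bilinear g & forall x y, g (p x) (p y) = f x y.
Proof.
move=> [fl fr] kl kr; have [s sK] := choice p_surj.
have fs x x' y y' : p x = p x' -> p y = p y' -> f x y = f x' y'.
  move=> px py; transitivity (f x' y); apply: subr0_eq.
    by rewrite -(linB (fl y)) kl // (linB p_lin) px subrr.
  by rewrite -(linB (fr x')) kr // (linB p_lin) py subrr.
exists (fun u v => f (s u) (s v)) => [|x y]; last by apply: fs; rewrite sK.
split=> [v|u] c x y /=; rewrite -?fl -?fr; apply: fs; by rewrite ?p_lin !sK.
Qed.

Lemma leibniz_image (brA : A -> A -> A) (brB : B -> B -> B) :
  {morph p : x y / brA x y >-> brB x y} -> is_bilinear brB ->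
  is_leibniz brA -> is_leibniz brB.
Proof.
move=> pM bB [_ leib]; split=> // x y z.
have [a <-] := p_surj x; have [b <-] := p_surj y; have [c <-] := p_surj z.
by rewrite -!pM leib (linB p_lin).
Qed.

End Descent.

(** * Leibniz and Lie identities for antisymmetric brackets *)

Section Antisymmetric.
Variables (K : fieldType) (L : lmodType K) (br : L -> L -> L).
Hypothesis br_bilinear : is_bilinear br.

Lemma anti_jacobi x y z : (forall x y, br x y = - br y x) ->
  br (br x y) z + br (br y z) x + br (br z x) y =
  br (br x y) z - br (br x z) y - br x (br y z).
Proof.
move=> anti; rewrite (anti _ x) (anti z x) -[- br x z]sub0r.
by rewrite (linB (br_bilinear.1 y)) (lin0 (br_bilinear.1 y)) sub0r addrAC.
Qed.

(** The characteristic enters here: antisymmetry gives [2 [x, x] = 0], and 2 is invertible. *)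
Lemma leibniz_lie : 2%N \notin [pchar K] -> is_leibniz br ->
  (forall x y, br x y = - br y x) -> is_lie br.
Proof.
move=> char_K [_ leib] anti; split=> // [x|x y z].
  have /eqP := anti x x; rewrite -addr_eq0 -mulr2n -scaler_nat scaler_eq0.
  by rewrite inE /= in char_K; rewrite (negPf char_K) => /eqP.
by rewrite anti_jacobi // leib subrr.
Qed.

Lemma lie_anti : is_lie br -> forall x y, br x y = - br y x.
Proof.
have [bl br'] := br_bilinear; move=> [_ alt _] x y.
apply/eqP; rewrite -addr_eq0; have := alt (x + y).
by rewrite (linD (bl _)) !(linD (br' _)) !alt add0r addr0 => ->.
Qed.

Lemma lie_leibniz : is_lie br -> is_leibniz br.
Proof.
move=> hb; split=> // x y z; have [_ _ jac] := hb.
by apply/esym/subr0_eq; rewrite -anti_jacobi ?jac //; apply: lie_anti.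
Qed.

End Antisymmetric.

(** * Subspaces defined by a predicate *)

Section Subspace.
Variables (K : fieldType) (L : lmodType K) (P : L -> Prop).
Hypotheses (P0 : P 0) (P_lin : forall c x y, P x -> P y -> P (c *: x + y)).

(** The closure proofs are arguments so that the submodule structure can be inferred from the
    predicate alone. *)
Definition subspace_pred (_ : P 0)
  (_ : forall c x y, P x -> P y -> P (c *: x + y)) : pred L := fun x => `[< P x >].
Local Notation S := (subspace_pred P0 P_lin).

Lemma subspace_closed : submod_closed S.
Proof.
split=> [|c x y /asboolP Px /asboolP Py]; apply/asboolP; first exact: P0.
exact: P_lin.
Qed.
HB.instance Definition _ := GRing.isSubmodClosed.Build K L S subspace_closed.

Record subspace : Type := Subspace { subspace_val :> L; _ : subspace_val \in S }.
HB.instance Definition _ := [isSub for subspace_val].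
HB.instance Definition _ := [Choice of subspace by <:].
HB.instance Definition _ := [SubChoice_isSubLmodule of subspace by <:].

Lemma subspaceP (x : subspace) : P x.
Proof. by case: x => x /= /asboolP. Qed.
Definition subspace_of (x : L) (Px : P x) : subspace :=
  Subspace (introT (asboolP _) Px).

End Subspace.

(** * The Lie algebra of linear endomorphisms *)

Section Endomorphisms.
Variables (K : fieldType) (W : lmodType K).

Lemma lin0_closed : linear (0 : W -> W).
Proof. by move=> c x y; rewrite /= scaler0 addr0. Qed.
Lemma lin_closed c (f g : W -> W) : linear f -> linear g -> linear (c *: f + g).
Proof.
move=> lf lg d x y; rewrite !fctE lf lg !scalerDr !scalerA mulrC !addrA.
by congr (_ + _); rewrite -!addrA; congr (_ + _); rewrite addrC.
Qed.

Definition endo : lmodType K := subspace lin0_closed lin_closed.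

Lemma endoP (f g : endo) : subspace_val f =1 subspace_val g -> f = g.
Proof. by move=> fg; apply: val_inj; apply: funext. Qed.

Lemma endo_commutator_lin (f g : endo) :
  linear (fun x => subspace_val g (subspace_val f x)
                   - subspace_val f (subspace_val g x)).
Proof.
move=> c x y; rewrite !(subspaceP f) !(subspaceP g) (subspaceP f).
by rewrite scalerBr opprD addrACA.
Qed.
(* The opposite of the usual commutator: right multiplications of a Leibniz
   algebra satisfy R_[y,z] = R_z R_y - R_y R_z. *)
Definition endo_bracket (f g : endo) : endo :=
  subspace_of lin0_closed lin_closed (@endo_commutator_lin f g).

Lemma endo_bracket_lie : is_lie endo_bracket.
Proof.
have linE c (f g : endo) x :
  subspace_val (c *: f + g) x = c *: subspace_val f x + subspace_val g x by [].
have brE (f g : endo) x : subspace_val (endo_bracket f g) x =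
  subspace_val g (subspace_val f x) - subspace_val f (subspace_val g x) by [].
split.
- split=> f c g h; apply: endoP => x;
    by rewrite linE !brE linE (subspaceP f) scalerBr opprD addrACA.
- by move=> f; apply: endoP => x; rewrite brE subrr.
- move=> f g h; apply: endoP => x.
  rewrite -[LHS]/(subspace_val (endo_bracket (endo_bracket f g) h) x
    + subspace_val (endo_bracket (endo_bracket g h) f) x
    + subspace_val (endo_bracket (endo_bracket h f) g) x).
  rewrite !brE !(linB (subspaceP _)) !opprB.
  (* The Jacobi sum has twelve signed triple composites; the permutation puts each next to its
     opposite. *)
  rewrite [LHS](AC ((2*2)*(2*2)*(2*2))
    ((1*8)*(2*11)*(3*6)*(4*9)*(5*12)*(7*10))) /=.
  by rewrite !subrr !addNr !addr0.
Qed.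

End Endomorphisms.

(** Complements [tensor_ext] for properties that are not equalities of linear maps, such as having a
    preimage. *)
Lemma tensor_ind (K : fieldType) (A B : lmodType K) (P : tensor A B -> Prop) :
  P 0 -> (forall c x y, P x -> P y -> P (c *: x + y)) ->
  (forall a b, P (pure a b)) -> forall x, P x.
Proof.
move=> P0 Plin Ppure x; rewrite (tensor_sum x).
elim: (repr x) => [|p s IH]; first by rewrite big_nil.
by rewrite big_cons -[pure _ _]scale1r; apply: Plin.
Qed.

(** * The kernels of the projections of Leib(V) to R(V) and to the graded Lie algebra *)

Section LeibnizToLie.
Variables (K : fieldType) (V : lmodType K).
Local Notation Leib := (Leib V).
Local Notation tpow := (tpow V).

Let shift_bil := leib_shift_bilinear V.
Let rmul_bil n := @leib_rmul_bilinear K V n.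
Let lie_bil := let: And3 b _ _ := lie_bracket_lie V in b.
Let proj_lin := @ronco_proj_linear K V.
Let iter_lin n := @lie_iter_linear K V n.

(* The degrees only agree up to addSn, hence the free index k. *)
Lemma leib_rmul_homog m n (a : tpow m) (b : tpow n) k : k = (m + n).+1 ->
  exists2 c : tpow k, leib_rmul b (dinj a) = dinj c
    & lie_val (lie_iter c) = lie_bracket (lie_iter a) (lie_iter b).
Proof.
elim: n m a b k => [|n IH] m a b k.
  rewrite addn0 => ->; exists (pure a b); last exact: lie_iter_pure.
  by rewrite -leib_shift_dinj.
rewrite addnS => ->; elim/(@tensor_ind K (tpow n) V): b => [|c x y|b v].
- exists 0; first by rewrite (lin0 ((rmul_bil n.+1).1 _)) (lin0 (@dinj_linear _ _ _)).
  by rewrite !(lin0 (@iter_lin _)) /= (lin0 (lie_bil.2 _)).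
- move=> [u xu lu] [w yw lw]; exists (c *: u + w).
    by rewrite (rmul_bil _).1 xu yw dinj_linear.
  by rewrite !lie_iter_linear /= lu lw lie_bil.2.
(* [d] represents [[a, b]] and [e] represents [[a (x) v, b]]; the recursion of [leib_rmul] combines
   them, matching [{a, {b, v}} = {{a, b}, v} - {{a, v}, b}]. *)
have [d bd ld] := IH m a b _ erefl.
have [e be le] := IH m.+1 (pure a v) b (m + n).+2 erefl.
exists (pure d v - e).
  rewrite /= tlift_pure; last exact: leib_rmulS_bilinear.
  by rewrite bd leib_shift_dinj leib_shift_dinj be (linB (@dinj_linear _ _ _)).
have [_ leib] := lie_leibniz lie_bil (lie_bracket_lie V).
rewrite (linB (@iter_lin _)) -[LHS]/(lie_val _ - lie_val _).
by rewrite !lie_iter_pure ld le lie_iter_pure leib.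
Qed.

(** Left-normed brackets span: by [leib_rmul_homog], a bracket of two values of [lie_iter] is again
    one. *)
Lemma lie_iter_surj n (x : Lie_ V n.+1) : exists t : tpow n, lie_iter t = x.
Proof.
(* Degree 0, which contains only 0, is carried along so that brackets with a factor of degree 0
   vanish. *)
suff H m y : lie_deg m y -> (m = 0%N -> y = 0) /\
    forall n, m = n.+1 -> exists t : tpow n, lie_val (lie_iter t) = y.
  have [_ /(_ n erefl)[t tx]] := H _ _ (Lie_P x).
  by exists t; apply: val_inj.
have br0l z : lie_bracket 0 z = 0 :> Lie V by exact: (lin0 (lie_bil.1 z)).
have br0r z : lie_bracket z 0 = 0 :> Lie V by exact: (lin0 (lie_bil.2 z)).
elim=> {m y} [v|[|m] [|k] y z _ [y0 yn] _ [z0 zn]|m|m c y z _ [y0 yn] _ [z0 zn]].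
- by split=> // _ [<-]; exists v.
- by rewrite y0 // br0l; split=> //.
- rewrite y0 // br0l; split=> // j _; exists 0.
  by rewrite (lin0 (@iter_lin _)).
- rewrite z0 // br0r; split=> // j _; exists 0.
  by rewrite (lin0 (@iter_lin _)).
- split=> // j; rewrite addnS addSn => -[<-].
  have [[s <-] [t <-]] := (yn _ erefl, zn _ erefl).
  by have [d _ <-] := leib_rmul_homog s t erefl; exists d.
- split=> // j _; exists 0; by rewrite (lin0 (@iter_lin _)).
- split=> [m0|j mj]; first by rewrite y0 // z0 // scaler0 addr0.
  have [[s <-] [t <-]] := (yn _ mj, zn _ mj); exists (c *: s + t).
  by rewrite lie_iter_linear.
Qed.


Lemma lie_proj_fin (x : Leib) : exists N, forall n, (N <= n)%N -> lie_iter (x n) = 0.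
Proof.
by have [N h] := dcoef_fin x; exists N => n /h ->; rewrite (lin0 (@iter_lin n)).
Qed.

(** The external direct sum, indexed like [tpow], makes [lie_proj] act componentwise. *)
Definition graded_Lie : lmodType K := dsum (fun n => Lie_ V n.+1).
Definition lie_proj (x : Leib) : graded_Lie := DSum (lie_proj_fin x).

Lemma lie_proj_linear : linear lie_proj.
Proof. by move=> c x y; apply: dsumP => n /=; rewrite iter_lin. Qed.

Lemma lie_proj_dinj n (t : tpow n) : lie_proj (dinj t) =
  @dinj K (fun n => Lie_ V n.+1) n (lie_iter t).
Proof.
apply: dsumP => k /=; have [<-|nk] := eqVneq n k; first by rewrite !dfwith_in.
by rewrite !dfwith_out // (lin0 (@iter_lin k)).
Qed.

Lemma lie_proj0 (x : Leib) : lie_proj x = 0 <-> forall n, lie_iter (x n) = 0.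
Proof.
split=> [x0 n|x0]; last exact: dsumP.
by rewrite -[LHS]/(lie_proj x n) x0.
Qed.

Lemma lie_proj_surj y : exists x, lie_proj x = y.
Proof.
have [N /dsum_sum ->] := dcoef_fin y.
elim: N => [|N [x IH]]; first by exists 0; rewrite big_ord0 (lin0 lie_proj_linear).
have [t ty] := lie_iter_surj (y N); exists (x + dinj t).
by rewrite big_ord_recr /= (linD lie_proj_linear) IH lie_proj_dinj ty.
Qed.

Lemma ronco_proj0 (x : Leib) : ronco_proj x = 0 <->
  x 0%N = 0 /\ forall n, ronco_proj_comp (x n.+1) = 0.
Proof.
split=> [px|[x0 xS]]; last by congr (_, _) => //; apply: dsumP.
split=> [|n]; first by rewrite -[LHS]/(ronco_proj x).1 px.
by rewrite -[LHS]/((ronco_proj x).2 n) px.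
Qed.

Lemma ronco_proj_surj (y : Ronco V) : exists x, ronco_proj x = y.
Proof.
have addP (y1 y2 : Ronco V) : (exists x, ronco_proj x = y1) ->
    (exists x, ronco_proj x = y2) -> exists x, ronco_proj x = y1 + y2.
  by move=> [x1 <-] [x2 <-]; exists (x1 + x2); rewrite (linD proj_lin).
case: y => v s; have -> : (v, s) = (v, 0) + (0, s) :> Ronco V.
  by congr (_, _); rewrite ?addr0 ?add0r.
apply: (addP _ (0, s)); first by exists (leib_gen v); rewrite ronco_proj_gen.
have [N /dsum_sum ->] := dcoef_fin s.
elim: N => [|N IH]; first by exists 0; rewrite big_ord0 (lin0 proj_lin).
have -> : (0, \sum_(n < N.+1) dinj (s n)) =
    (0, \sum_(n < N) dinj (s n)) + (0, dinj (s N)) :> Ronco V.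
  by rewrite big_ord_recr; congr (_, _); rewrite addr0.
apply: addP IH _; elim/(@tensor_ind K): (s N) => [|c y z [a ya] [b zb]|a v'].
- by exists 0; rewrite (lin0 proj_lin) (lin0 (@dinj_linear _ _ _)).
- exists (c *: a + b); rewrite proj_lin ya zb dinj_linear.
  by congr (_, _); rewrite /= scaler0 addr0.
(* The summand of index [N] in [Ronco_sum] comes from index [N.+1] in [Leib], because of the last
   letter. *)
have [t <-] := lie_iter_surj a; exists (dinj (n := N.+1) (pure t v')).
exact: ronco_proj_pure.
Qed.

Let bracket_gen_bil n : is_bilinear
  (fun (a : Lie_ V n.+1) v => lie_bracket (lie_val a) (lie_gen v)).
Proof. by split=> [v|a] c x y /=; rewrite ?lie_gen_linear ?lie_bil.1 ?lie_bil.2. Qed.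

(** Bracketing with the last letter is bilinear, so [lie_iter] factors through [ronco_proj_comp];
    this puts the kernel of [ronco_proj] inside that of [lie_proj]. *)
Lemma lie_iterS n (t : tpow n.+1) : lie_val (lie_iter t) =
  tlift (fun a v => lie_bracket (lie_val a) (lie_gen v)) (ronco_proj_comp t).
Proof.
apply: (@tensor_ext K (tpow n) V (Lie V) (fun t => lie_val (@lie_iter K V n.+1 t))
  (fun t => tlift _ (ronco_proj_comp t))) t => [c x y|c x y|a v].
- by rewrite iter_lin.
- by rewrite ronco_proj_comp_linear (tlift_linear (bracket_gen_bil n)).
rewrite lie_iter_pure /ronco_proj_comp /tmap !tlift_pure //; first exact: bracket_gen_bil.
by apply: tmap_bilinear; first exact: iter_lin.
Qed.

Lemma ronco_proj0_lie (x : Leib) : ronco_proj x = 0 -> lie_proj x = 0.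
Proof.
move=> /ronco_proj0[x0 xS]; apply/lie_proj0 => -[|n].
  by rewrite x0 (lin0 (@iter_lin 0)).
apply: val_inj => /=; rewrite lie_iterS xS.
exact: lin0 (tlift_linear (bracket_gen_bil n)).
Qed.

Lemma ronco_proj_shift (x : Leib) (v : V) :
  lie_proj x = 0 -> ronco_proj (leib_shift x v) = 0.
Proof.
move=> /lie_proj0 x0; apply/ronco_proj0; split=> // n.
rewrite /= /ronco_proj_comp /tmap tlift_pure; last first.
  by apply: tmap_bilinear; first exact: iter_lin.
by rewrite x0 (bil0l _ (@pure_bilinear _ _ _)).
Qed.

Lemma ronco_proj_bracketl (x y : Leib) :
  lie_proj x = 0 -> ronco_proj (leib_bracket x y) = 0.
Proof.
move=> x0; have [N /dsum_sum ->] := dcoef_fin y.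
have lin := (leib_bracket_bilinear V).2 x.
elim: N => [|N IH]; first by rewrite big_ord0 (lin0 lin) (lin0 proj_lin).
rewrite big_ord_recr /= (linD lin) (linD proj_lin) {}IH add0r leib_bracket_dinj.
elim: N (y N) x x0 {lin} => {y} [|n IH] t x x0; first exact: ronco_proj_shift.
elim/(@tensor_ind K (tpow n) V): t => [|c s t IHs IHt|a v].
- by rewrite (lin0 ((rmul_bil n.+1).1 _)) (lin0 proj_lin).
- by rewrite (rmul_bil _).1 proj_lin IHs IHt scaler0 addr0.
rewrite /= tlift_pure; last exact: leib_rmulS_bilinear.
(* Both [leib_rmul a x] and [leib_shift x v] are killed by [ronco_proj], hence by [lie_proj], so the
   shift lemma and [IH] apply to them in turn. *)
rewrite (linB proj_lin) ronco_proj_shift ?IH ?subrr //.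
  exact/ronco_proj0_lie/ronco_proj_shift.
exact/ronco_proj0_lie/IH.
Qed.

Definition shift_endo (v : V) : endo Leib :=
  subspace_of (@lin0_closed K Leib) (@lin_closed K Leib) (shift_bil.1 v).

Lemma shift_endo_linear : linear shift_endo.
Proof. by move=> c u v; apply: endoP => x; rewrite /= shift_bil.2. Qed.

(** The recursion of [leib_rmul] is [endo_bracket], so right multiplication is the Lie homomorphism
    extending [shift_endo], evaluated at [lie_iter t]. *)
Lemma leib_rmul_lie n (t : tpow n) (x : Leib) : leib_rmul t x =
  subspace_val (llift (@endo_bracket K Leib) shift_endo (lie_iter t)) x.
Proof.
have hb := endo_bracket_lie Leib.
have [lin morph] := llift_hom hb shift_endo_linear.
elim: n t x => [|n IH] t x; first by rewrite llift_gen //; apply: shift_endo_linear.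
elim/(@tensor_ind K (tpow n) V): t => [|c s t IHs IHt|a v].
- by rewrite (lin0 ((rmul_bil n.+1).1 _)) (lin0 (@iter_lin _)) (lin0 lin).
- by rewrite (rmul_bil n.+1).1 (@iter_lin n.+1) lin IHs IHt.
rewrite lie_iter_pure morph /= tlift_pure; last exact: leib_rmulS_bilinear.
by rewrite !llift_gen ?IH //; apply: shift_endo_linear.
Qed.

Lemma leib_bracket0 (x y : Leib) : lie_proj y = 0 -> leib_bracket x y = 0.
Proof.
have [lin _] := llift_hom (endo_bracket_lie Leib) shift_endo_linear.
move=> /lie_proj0 y0; rewrite /leib_bracket /dlift big1 // => n _.
by rewrite leib_rmul_lie y0 (lin0 lin).
Qed.

(** On homogeneous arguments [leib_rmul_homog] turns both products into brackets of [Lie V], which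
    are antisymmetric. *)
Lemma lie_proj_anti (x y : Leib) :
  lie_proj (leib_bracket x y) = - lie_proj (leib_bracket y x).
Proof.
have [bl br] := leib_bracket_bilinear V.
apply/eqP; rewrite -addr_eq0; apply/eqP; rewrite -(linD lie_proj_linear).
apply: (@dsum_ext K tpow graded_Lie (fun x => lie_proj
  (leib_bracket x y + leib_bracket y x)) (fun=> 0)) x => [c u v|c u v|m a].
- by rewrite bl br addrACA -scalerDr lie_proj_linear.
- by rewrite scaler0 addr0.
apply: (@dsum_ext K tpow graded_Lie (fun y => lie_proj
  (leib_bracket (dinj a) y + leib_bracket y (dinj a))) (fun=> 0)) y
  => [c u v|c u v|n b].
- by rewrite bl br addrACA -scalerDr lie_proj_linear.
- by rewrite scaler0 addr0.
rewrite !leib_bracket_dinj; have [c -> lc] := leib_rmul_homog a b erefl.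
have [|d -> ld] := @leib_rmul_homog _ _ b a (m + n).+1; first by rewrite addnC.
rewrite (linD lie_proj_linear) !lie_proj_dinj -(linD (@dinj_linear _ _ _)).
rewrite [X in dinj X](_ : _ = 0) ?(lin0 (@dinj_linear _ _ _)) //.
apply: val_inj; rewrite -[LHS]/(lie_val _ + lie_val _) lc ld.
by rewrite (lie_anti lie_bil (lie_bracket_lie V)) addNr.
Qed.

End LeibnizToLie.

(** * The universal property of the free Leibniz algebra *)

Section LeibnizLift.
Variables (K : fieldType) (V L : lmodType K) (br : L -> L -> L) (f : V -> L).
Hypotheses (br_leibniz : is_leibniz br) (f_lin : linear f).

(** The left-normed bracket of the images of the letters, forced by [[w, v] = w (x) v]. *)
Fixpoint tpow_lift (n : nat) : tpow V n -> L :=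
  match n return tpow V n -> L with
  | 0 => f
  | m.+1 => tlift (fun (a : tpow V m) (v : V) => br (tpow_lift a) (f v))
  end.

Let br_bil := br_leibniz.1.

Lemma tpow_liftS_bilinear n : linear (@tpow_lift n) ->
  is_bilinear (fun (a : tpow V n) (v : V) => br (tpow_lift a) (f v)).
Proof.
by move=> lin; split=> [v|a] c x y /=; rewrite ?lin ?f_lin ?br_bil.1 ?br_bil.2.
Qed.

Lemma tpow_lift_linear n : linear (@tpow_lift n).
Proof. by elim: n => [//|n IH]; apply/tlift_linear/tpow_liftS_bilinear. Qed.

Lemma tpow_lift_pure n (a : tpow V n) v :
  @tpow_lift n.+1 (pure a v) = br (tpow_lift a) (f v).
Proof. exact/tlift_pure/tpow_liftS_bilinear/tpow_lift_linear. Qed.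

Definition leib_lift : Leib V -> L := dlift tpow_lift.

Lemma leib_lift_linear : linear leib_lift.
Proof. exact/dlift_linear/tpow_lift_linear. Qed.

Lemma leib_lift_dinj n (t : tpow V n) : leib_lift (dinj t) = tpow_lift t.
Proof. exact/dlift_dinj/tpow_lift_linear. Qed.

Lemma leib_lift_shift x v : leib_lift (leib_shift x v) = br (leib_lift x) (f v).
Proof.
apply: (@dsum_ext K (tpow V) L (fun x => leib_lift (leib_shift x v))
  (fun x => br (leib_lift x) (f v))) x => [c x y|c x y|n t].
- by rewrite (leib_shift_bilinear V).1 leib_lift_linear.
- by rewrite leib_lift_linear br_bil.1.
by rewrite leib_shift_dinj !leib_lift_dinj tpow_lift_pure.
Qed.

Lemma leib_lift_rmul n (t : tpow V n) x :
  leib_lift (leib_rmul t x) = br (leib_lift x) (tpow_lift t).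
Proof.
elim: n t x => [|n IH] t x; first exact: leib_lift_shift.
have rmul_lin := (@leib_rmul_bilinear K V n.+1).1 x.
elim/(@tensor_ind K (tpow V n) V): t => [|c s t IHs IHt|a v].
- rewrite (lin0 rmul_lin) (lin0 leib_lift_linear).
  by rewrite (lin0 (@tpow_lift_linear n.+1)) (lin0 (br_bil.2 _)).
- by rewrite rmul_lin leib_lift_linear IHs IHt (@tpow_lift_linear n.+1) br_bil.2.
rewrite tpow_lift_pure br_leibniz.2 /= tlift_pure; last exact: leib_rmulS_bilinear.
by rewrite (linB leib_lift_linear) leib_lift_shift !IH leib_lift_shift.
Qed.

Lemma leib_lift_bracket : {morph leib_lift : x y / leib_bracket x y >-> br x y}.
Proof.
move=> x y; have [lb rb] := leib_bracket_bilinear V.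
apply: (@dsum_ext K (tpow V) L (fun y => leib_lift (leib_bracket x y))
  (fun y => br (leib_lift x) (leib_lift y))) y => [c y z|c y z|n t].
- by rewrite rb leib_lift_linear.
- by rewrite leib_lift_linear br_bil.2.
by rewrite leib_bracket_dinj leib_lift_rmul leib_lift_dinj.
Qed.

Lemma leib_lift_unique (g : Leib V -> L) : is_hom (@leib_bracket K V) br g ->
  (forall v, g (leib_gen v) = f v) -> g =1 leib_lift.
Proof.
move=> [g_lin gM] g_gen; apply: (@dsum_ext K (tpow V) L) => [||n t].
- exact: g_lin.
- exact: leib_lift_linear.
rewrite leib_lift_dinj; elim: n t => [|n IH] t; first exact: g_gen.
apply: (@tensor_ext K (tpow V n) V L (fun t => g (@dinj K (tpow V) n.+1 t))
  (@tpow_lift n.+1)) t => [c x y||a v].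
- by rewrite dinj_linear g_lin.
- exact: (@tpow_lift_linear n.+1).
by rewrite tpow_lift_pure -leib_bracket_gen gM IH g_gen.
Qed.

End LeibnizLift.

(* The bracket of a Ronco algebra [h] depends only on the classes of its
   arguments in the Lie quotient, so on [a (x) v] the lift of [f] depends only
   on [v] and on the image of [a] in the free Lie algebra. *)
Lemma leib_lift_ronco (K : fieldType) (V h : lmodType K) (br : h -> h -> h)
    (f : V -> h) : is_ronco br -> linear f ->
  forall x : Leib V, ronco_proj x = 0 -> leib_lift br f x = 0.
Proof.
move=> [br_leib [A [l [brA [brl [i [p [_ brl_lie ext]]]]]]]] f_lin.
have [p_lin pM] := central_hom_p ext.
(* By centrality the bracket of [h] descends to a bilinear map [b] from the Lie quotient [l] to
   [h]. *)
have [||b b_bil bE] := descend_bilinear p_lin (central_surj ext) br_leib.1.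
- by move=> x y /(central_exact ext)[a <-]; apply: central_l ext _ _.
- by move=> x y /(central_exact ext)[a <-]; apply: central_r ext _ _.
have pf_lin : linear (p \o f) by move=> c u v /=; rewrite f_lin p_lin.
have [th_lin thM] := llift_hom brl_lie pf_lin.
set th := llift brl (p \o f) in th_lin thM.
have thE n (t : tpow V n) : th (lie_iter t) = p (tpow_lift br f t).
  elim: n t => [|n IH] t; first exact: llift_gen.
  apply: (@tensor_ext K (tpow V n) V l (fun t => th (@lie_iter K V n.+1 t))
    (fun t => p (@tpow_lift K V h br f n.+1 t))) t => [c x y|c x y|a v].
  - by rewrite lie_iter_linear th_lin.
  - by rewrite tpow_lift_linear // p_lin.
  by rewrite lie_iter_pure thM IH tpow_lift_pure // pM [th _]llift_gen.
pose k n (a : Lie_ V n.+1) v := b (th (lie_val a)) (p (f v)).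
have k_bil n : is_bilinear (@k n).
  split=> [v|a] c x y; first by rewrite /k th_lin b_bil.1.
  by rewrite /k f_lin p_lin b_bil.2.
have liftE n t : @tpow_lift K V h br f n.+1 t = tlift (@k n) (ronco_proj_comp t).
  apply: (@tensor_ext K (tpow V n) V h (@tpow_lift K V h br f n.+1)
    (fun t => tlift (@k n) (ronco_proj_comp t))) t => [|c x y|a v].
  - exact: (tpow_lift_linear br_leib f_lin (n := n.+1)).
  - by rewrite ronco_proj_comp_linear (tlift_linear (k_bil n)).
  rewrite tpow_lift_pure // /ronco_proj_comp /tmap tlift_pure; last first.
    by apply: tmap_bilinear; first exact: lie_iter_linear.
  by rewrite tlift_pure // /k thE bE.
(* Index 0 is separate: there [ronco_proj] is the identity of [V] and the lift is [f]. *)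
move=> x /ronco_proj0[x0 xS]; rewrite /leib_lift /dlift big1 // => -[[|n] _] _ /=.
  by rewrite x0 (lin0 f_lin).
by rewrite -/(@tpow_lift K V h br f n.+1 (x n.+1)) liftE xS
           (lin0 (tlift_linear (k_bil n))).
Qed.

(** * R(V) as a Ronco algebra and its freeness *)

Lemma ronco_is_ronco (K : fieldType) (V : lmodType K)
    (br : Ronco V -> Ronco V -> Ronco V) : 2%N \notin [pchar K] ->
  is_bilinear br ->
  {morph @ronco_proj K V : x y / leib_bracket x y >-> br x y} -> is_ronco br.
Proof.
move=> char_K br_bil brM; have leib := leib_bracket_leibniz V.
have lp_lin := @lie_proj_linear K V; have rp_lin := @ronco_proj_linear K V.
split; first exact: (leibniz_image rp_lin (@ronco_proj_surj K V) brM br_bil leib).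
have f_bil : is_bilinear (fun x y => lie_proj (@leib_bracket K V x y)).
  by split=> [y|x] c u v; rewrite ?leib.1.1 ?leib.1.2 lp_lin.
have [||brh brh_bil brhE] :=
  descend_bilinear lp_lin (@lie_proj_surj K V) f_bil.
- by move=> x y x0; apply/ronco_proj0_lie/ronco_proj_bracketl.
- by move=> x y y0; rewrite leib_bracket0 // (lin0 lp_lin).
have brh_lie : is_lie brh.
  apply: leibniz_lie => //.
    apply: (leibniz_image lp_lin (@lie_proj_surj K V) _ brh_bil leib) => x y.
    by rewrite brhE.
  move=> u v; have [x <-] := lie_proj_surj u; have [y <-] := lie_proj_surj v.
  by rewrite !brhE lie_proj_anti.
have [p p_lin pE] :=
  descend_linear rp_lin (@ronco_proj_surj K V) lp_lin (@ronco_proj0_lie K V).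
have ker_lin c x y : p x = 0 -> p y = 0 -> p (c *: x + y) = 0.
  by move=> px py; rewrite p_lin px py scaler0 addr0.
pose A : lmodType K := subspace (lin0 p_lin) ker_lin.
exists A, (graded_Lie V), (fun _ _ => 0), brh, (fun a : A => subspace_val a), p.
(* A lift of [x] lies in the kernel of [lie_proj]: its products from the left die in R(V), those
   from the right already in Leib(V). *)
have central x y : p x = 0 -> br x y = 0 /\ br y x = 0.
  have [x' <-] := ronco_proj_surj x; have [y' <-] := ronco_proj_surj y.
  rewrite pE -!brM => x0; split; first exact: ronco_proj_bracketl.
  by rewrite leib_bracket0 // (lin0 rp_lin).
split=> //.
  split; last by move=> *; rewrite subrr.
  by split=> ? c ? ?; rewrite scaler0 addr0.
split=> //.
- split=> // a b; by rewrite (central _ _ (subspaceP a)).1.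
- split=> // x y.
  have [x' <-] := ronco_proj_surj x; have [y' <-] := ronco_proj_surj y.
  by rewrite -brM !pE brhE.
- exact: val_inj.
- move=> x; split=> [px|[a <-]]; last exact: (subspaceP a).
  by exists (subspace_of (lin0 p_lin) ker_lin px).
- move=> y; have [x <-] := lie_proj_surj y; exists (ronco_proj x); exact: pE.
- by move=> a x; exact: (central _ _ (subspaceP a)).1.
- by move=> a x; exact: (central _ _ (subspaceP a)).2.
Qed.

Theorem theorem8 (K : fieldType) (char_K : 2%N \notin [pchar K])
    (V : lmodType K) :
  (exists! br : Ronco V -> Ronco V -> Ronco V,
     is_bilinear br /\
     {morph @ronco_proj K V : x y / leib_bracket x y >-> br x y}) /\
  (forall br : Ronco V -> Ronco V -> Ronco V,
     is_bilinear br ->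
     {morph @ronco_proj K V : x y / leib_bracket x y >-> br x y} ->
     is_free_ronco br (@ronco_gen K V)).
Proof.
have rp_lin := @ronco_proj_linear K V; have rp_surj := @ronco_proj_surj K V.
have [lb_bil _] := leib_bracket_leibniz V.
split.
  have f_bil : is_bilinear (fun x y => ronco_proj (@leib_bracket K V x y)).
    by split=> [y|x] c u v; rewrite ?lb_bil.1 ?lb_bil.2 rp_lin.
  (* The kernel of [ronco_proj] is a two-sided ideal, being contained in that of [lie_proj]. *)
  have [||br br_bil brE] := descend_bilinear rp_lin rp_surj f_bil.
  - by move=> x y /ronco_proj0_lie; apply: ronco_proj_bracketl.
  - by move=> x y /ronco_proj0_lie y0; rewrite leib_bracket0 // (lin0 rp_lin).
  exists br; split; first by split=> // x y; rewrite brE.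
  move=> br' [_ brM']; apply: funext => u; apply: funext => v.
  by have [x <-] := rp_surj u; have [y <-] := rp_surj v; rewrite brE -brM'.
move=> br br_bil brM; split.
- exact: ronco_is_ronco.
- by move=> c u v; congr (_, _); rewrite /= scaler0 addr0.
- by move=> u v [].
move=> h brh h_ronco f f_lin; have h_leib := h_ronco.1.
have [g g_lin gE] := descend_linear rp_lin rp_surj
  (leib_lift_linear h_leib f_lin) (leib_lift_ronco h_ronco f_lin).
exists g; split.
  split; last by move=> v; rewrite -ronco_proj_gen gE leib_lift_dinj.
  split=> // u v; have [x <-] := rp_surj u; have [y <-] := rp_surj v.
  by rewrite -brM !gE leib_lift_bracket.
(* Uniqueness is pulled back to Leib(V): [g'] after [ronco_proj] is a homomorphism extending [f],
   hence equals [leib_lift]. *)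
move=> g' [[g'_lin g'M] g'_gen]; apply: funext => u; have [x <-] := rp_surj u.
rewrite gE; apply/esym; move: x.
apply: (@leib_lift_unique K V h brh f h_leib f_lin (g' \o @ronco_proj K V)).
  by split=> [c x y|x y] /=; rewrite ?rp_lin ?g'_lin ?brM ?g'M.
by move=> v /=; rewrite ronco_proj_gen.
Qed.
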